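(* Let $\mathfrak{g}$ be a complex semisimple Lie algebra, $\mathfrak{h}$ a Cartan subalgebra of $\mathfrak{g}$, and let $\{\mathfrak{n}=V\oplus\mathfrak{g},B^*\}$ be the complex 2-step nilpotent Lie algebra described in the context. Let $\Lambda\subset\mathrm{Hom}(\mathfrak{h},\mathbb{C})$ be the set of nonzero weights of $V$ and $V=V_0+\sum_{\lambda\in\Lambda}V_\lambda$ the weight space decomposition. Then, for the bracket $[\,,]$ of $\mathfrak{n}$ (and $\mathrm{ad}$ taken in $\mathfrak{n}$): 1) For every $\lambda\in\Lambda$ and every nonzero $v_\lambda\in V_\lambda$, $\mathrm{ad}\,v_\lambda(V_{-\lambda})=\mathbb{C}\text{-span}(t_\lambda)$, where $t_\lambda$ is the element of $\mathfrak{h}$ such that $\lambda(H)=B^*(t_\lambda,H)$ for all $H\in\mathfrak{h}$. 2) $[V_\lambda,V_\mu]=\mathfrak{g}_{\lambda+\mu}$ for all $\lambda,\mu\in\Lambda$ with $\lambda+\mu\neq0$. 3) $[V_0,V_\mu]=\mathfrak{g}_\mu$ for all $\mu\in\Lambda$. 4) $[V_0,V_0]=\{0\}$.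
   Context: $V$ is a finite dimensional complex $\mathfrak{g}$-module. $B^*$ is a nondegenerate symmetric complex bilinear form on $\mathfrak{n}=V\oplus\mathfrak{g}$ such that $V$ and $\mathfrak{g}$ are $B^*$-orthogonal, $B^*(Xv,v')+B^*(v,Xv')=0$ for $v,v'\in V$, $X\in\mathfrak{g}$, and $B^*(\mathrm{ad}X(Y),Z)+B^*(Y,\mathrm{ad}X(Z))=0$ for $X,Y,Z\in\mathfrak{g}$ (with $\mathrm{ad}$ of $\mathfrak{g}$). The bracket of $\mathfrak{n}$ is defined by: $\mathfrak{g}$ is central in $\mathfrak{n}$, $[\mathfrak{n},\mathfrak{n}]\subseteq\mathfrak{g}$, and $B^*([v,v'],Z)=B^*(Zv,v')$ for $v,v'\in V$, $Z\in\mathfrak{g}$. Here $V_\lambda=\{v\in V: Hv=\lambda(H)v\ \forall H\in\mathfrak{h}\}$, and $V_0$ is the zero weight space (possibly $\{0\}$). $\Phi$ is the set of roots of $\mathfrak{h}$ in $\mathfrak{g}$; for $\alpha\in\Phi$, $\mathfrak{g}_\alpha$ is the corresponding root space; for $\mu\in\mathrm{Hom}(\mathfrak{h},\mathbb{C})\setminus\Phi$, $\mathfrak{g}_\mu$ is defined to be $\{0\}$. For subspaces $A,B$, $[A,B]$ is the span of all brackets $[a,b]$. *)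

(* Defs.v *)
From HB Require Import structures.
From mathcomp Require Import all_boot all_order all_algebra.
From mathcomp Require Import sesquilinear complex.
From mathcomp Require Import boolp classical_sets reals.

Set Implicit Arguments.
Unset Strict Implicit.
Unset Printing Implicit Defensive.

Import Order.TTheory GRing.Theory Num.Theory.

Local Open Scope ring_scope.
Local Open Scope classical_set_scope.

(* A finite dimensional Lie algebra over F is a vectType L together with a
   bilinear map br : {bilinear L -> L -> L} satisfying lie_bracket br. *)

Section LieAlgebras.
Variables (F : fieldType) (L : vectType F).
Implicit Types (br : L -> L -> L) (A B : set L) (U I h : {vspace L}).

Definition lie_bracket br : Prop :=
  (forall x, br x x = 0) /\
  (forall x y z, br x (br y z) + br y (br z x) + br z (br x y) = 0).

Definition set_span A : set L :=
  [set x | exists2 s : seq L, (forall y, y \in s -> A y) & x \in <<s>>%VS].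

(* [A, B]: the span of all the brackets [a, b], not just their set. *)
Definition bracket_span br A B : set L :=
  set_span [set br a b | a in A & b in B].

Definition derived_series br A (n : nat) : set L :=
  iter n (fun D => bracket_span br D D) A.

Definition lie_solvable br A : Prop :=
  exists n, derived_series br A n = [set 0].

Definition lie_ideal br I : Prop := forall x y, y \in I -> br x y \in I.

Definition lie_semisimple br : Prop :=
  forall I, lie_ideal br I -> lie_solvable br [set` I] -> I = 0%VS.

Definition lie_abelian br U : Prop :=
  forall x y, x \in U -> y \in U -> br x y = 0.

Definition diagonalizable_endo (f : L -> L) : Prop :=
  exists2 e : seq L, basis_of fullv e &
    forall x, x \in e -> exists c : F, f x = c *: x.

(* Cartan subalgebras of a complex semisimple Lie algebra, as in Helgason:
   h is a maximal abelian subalgebra and ad H is semisimple for all H in h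
   (over an algebraically closed field, semisimple means diagonalizable). *)
Definition cartan_subalgebra br h : Prop :=
  [/\ lie_abelian br h,
      (forall U, lie_abelian br U -> (h <= U)%VS -> U = h) &
      forall H, H \in h -> diagonalizable_endo (br H)].

End LieAlgebras.

Definition lie_module (F : fieldType) (g V : vectType F) (br : g -> g -> g)
    (act : g -> V -> V) : Prop :=
  forall X Y v, act (br X Y) v = act X (act Y v) - act Y (act X v).

(* The elements of Hom(h, F) are the linear functions in 'Hom(subvs_of h, F^o),
   F^o being F seen as a vector space over itself; vsval is the inclusion of h
   in g. *)
Section Weights.
Variables (F : fieldType) (g W : vectType F) (h : {vspace g}).
Implicit Types (act : g -> W -> W) (lambda : 'Hom(subvs_of h, F^o)).

Definition weight_space act lambda : set W :=
  [set w | forall H : subvs_of h, act (vsval H) w = (lambda H : F) *: w].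

Definition nonzero_weight act lambda : Prop :=
  lambda != 0 /\ exists2 w, weight_space act lambda w & w != 0.

End Weights.

Section Roots.
Variables (F : fieldType) (g : vectType F) (br : g -> g -> g) (h : {vspace g}).

Definition is_root (alpha : 'Hom(subvs_of h, F^o)) : Prop :=
  nonzero_weight br alpha.

(* With this convention root_space 0 is {0}, not h. *)
Definition root_space (mu : 'Hom(subvs_of h, F^o)) : set g :=
  if `[< is_root mu >] then weight_space br mu else [set 0].

End Roots.

(* n = V + g is the product (V * g)%type, with summands embedded by inV, inG. *)
Section TwoStep.
Variables (F : fieldType) (g V : vectType F).

Definition inV (v : V) : (V * g)%type := (v, 0).
Definition inG (X : g) : (V * g)%type := (0, X).

Definition invariant_form (brg : g -> g -> g) (act : g -> V -> V)
    (B : (V * g)%type -> (V * g)%type -> F) : Prop :=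
  [/\ (forall v X, B (inV v) (inG X) = 0),
      (forall X v v', B (inV (act X v)) (inV v') +
                      B (inV v) (inV (act X v')) = 0) &
      (forall X Y Z, B (inG (brg X Y)) (inG Z) +
                     B (inG Y) (inG (brg X Z)) = 0)].

(* For a nondegenerate B making V and g orthogonal, these three conditions
   determine the Lie bracket brn completely. *)
Definition two_step_bracket (act : g -> V -> V)
    (B : (V * g)%type -> (V * g)%type -> F)
    (brn : (V * g)%type -> (V * g)%type -> (V * g)%type) : Prop :=
  [/\ (forall x Z, brn x (inG Z) = 0),
      (forall x y, exists Z, brn x y = inG Z) &
      (forall v v' Z, B (brn (inV v) (inV v')) (inG Z) =
                      B (inV (act Z v)) (inV v'))].

End TwoStep.

Arguments inV {F g V} v.
Arguments inG {F g V} X.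

(* Main.v *)
Require Import Defs.
From HB Require Import structures.
From mathcomp Require Import all_boot all_order all_algebra.
From mathcomp Require Import sesquilinear complex ring.
From mathcomp Require Import boolp classical_sets reals.

Set Implicit Arguments.
Unset Strict Implicit.
Unset Printing Implicit Defensive.

Import Order.TTheory GRing.Theory Num.Theory.
Import VectorInternalTheory.

Local Open Scope ring_scope.
Local Open Scope classical_set_scope.

(** The form [B] transports everything to representation theory.  If [v] and
    [w] are weight vectors of weights [lambda] and [mu], invariance gives the
    bracket [[v, w]] the weight [lambda + mu] in g, and
    [B ([v, w], Z) = B (Z v, w)].  For [mu = - lambda] the bracket therefore
    lies in h and equals [B (v, w) t_lambda] ([brn_opposite]), which yields 1)
    and 4), since a nonzero vector of [V_lambda] pairs nontrivially with some
    vector of [V_(- lambda)] ([form_pairing]).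

    For 2) and 3) assume that [alpha = lambda + mu] is a root; its root space
    is a line, so one nonzero bracket is enough.  Let [f] be the lowering
    element of an sl2 triple [(e, H, f)] of [alpha], so [alpha H = 2].  If
    [f v != 0] for some [v] in [V_lambda], then [f v] pairs nontrivially with
    some [w] in [V_mu], that is, [B ([v, w], f) != 0].  If [f] kills nonzero
    vectors of both [V_lambda] and [V_mu], these are lowest weight vectors, so
    [lambda H <= 0] and [mu H <= 0], against [lambda H + mu H = 2].  When
    [lambda = 0] the vectors of [V_mu], on which [H] acts by 2, suffice.

    The invariant form on g given with the problem makes the structure theory
    of g short: it replaces the Killing form.  A root [alpha] satisfies
    [alpha t_alpha != 0] because otherwise a root vector and an opposite one
    would generate a Heisenberg algebra whose centre acts by a nonzero scalar
    on a finite dimensional space ([form_root_nonisotropic]); a root space is a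
    line because a root vector orthogonal to [f] commutes with [f] and would be
    a lowest weight vector of weight 2 ([root_space_line]).

    Finally V has to be the sum of its weight spaces.  In a finite dimensional
    sl2-module the operator [H] is diagonalizable, by an elementary argument
    with the Casimir operator ([sl2_semisimple]).  The coroots span h
    ([coroots_span]) and commute, so they diagonalize simultaneously on V and
    their joint eigenvectors are weight vectors ([module_decomposition]). *)

(** * Semisimple operators and joint eigenvectors *)

(** Decides identities between linear combinations of vectors by reading them
    in coordinates, where they become ring identities. *)
Ltac module :=
  apply: (can_inj v2rK);
  rewrite ?(linearD v2r, linearN v2r, linearZ_LR v2r, linear0 v2r) /=;
  apply/rowP => ?; rewrite !mxE; ring.

Section LinearOperators.
Variables (F : numClosedFieldType) (W : vectType F).

Definition shift (T : W -> W) (c : F) (v : W) : W := T v - c *: v.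

(** Diagonalizability in the form that is convenient here: over an
    algebraically closed field it amounts to the absence of Jordan blocks of
    size 2. *)
Definition semisimple_op (T : W -> W) : Prop :=
  forall c v, shift T c (shift T c v) = 0 -> shift T c v = 0.

Definition vec_sum (P : W -> Prop) (v : W) : Prop :=
  exists2 s : seq W, (forall w, w \in s -> P w) & v = \sum_(w <- s) w.

Lemma shift_linear (T : {linear W -> W}) c : linear (shift T c).
Proof. by move=> a u v; rewrite /shift linearP; module. Qed.

HB.instance Definition _ (T : {linear W -> W}) c :=
  GRing.isLinear.Build F W W _ (shift T c) (shift_linear T c).

Lemma shift_eq0 (T : W -> W) c v : shift T c v = 0 <-> T v = c *: v.
Proof. by rewrite /shift; split=> [/eqP|->]; rewrite ?subrr // subr_eq0 => /eqP. Qed.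

(** Cayley-Hamilton, with the characteristic polynomial split into linear
    factors. *)
Lemma mx_annihilated n (A : 'M[F]_n) :
  exists cs : seq F, forall u : 'rV_n,
    foldl (fun w c => w *m A - c *: w) u cs = 0.
Proof.
case: n A => [|n] A; first by exists [::] => u; rewrite [u]thinmx0.
have [cs pE] := closed_field_poly_normal (char_poly A).
exists cs => u.
have -> : foldl (fun w c => w *m A - c *: w) u cs =
    u *m horner_mx A (\prod_(c <- cs) ('X - c%:P)).
  elim: cs u {pE} => [|c cs IH] u /=; first by rewrite big_nil rmorph1 mulmx1.
  rewrite IH big_cons rmorphM /= mulmxA; congr (_ *m _).
  by rewrite rmorphB /= horner_mx_X horner_mx_C mulmxBr mul_mx_scalar.
have : horner_mx A (char_poly A) = 0 by apply: Cayley_Hamilton.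
rewrite pE (monicP (char_poly_monic A)) scale1r => ->.
by rewrite mulmx0.
Qed.

Lemma op_annihilated (T : {linear W -> W}) :
  exists cs : seq F, forall v, foldl (fun w c => shift T c w) v cs = 0.
Proof.
have [cs csP] := mx_annihilated (lin1_mx (v2r \o T \o r2v)).
exists cs => v; apply: (can_inj v2rK); rewrite linear0 -[RHS](csP (v2r v)).
elim: cs v {csP} => [|c cs IH] v //=; rewrite IH; congr (foldl _ _ cs).
by rewrite mul_rV_lin1 /= v2rK /shift linearB linearZ.
Qed.

(** The spectrum of an operator is finite. *)
Lemma eigenvalue_avoid (T : {linear W -> W}) (c : nat -> F) :
  injective c -> exists k, forall v, shift T (c k) v = 0 -> v = 0.
Proof.
move=> c_inj; have [cs csP] := op_annihilated T.
have [k ckP] : exists k, c k \notin cs.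
  apply/not_existsP => all_in.
  have: (size (map c (iota 0 (size cs).+1)) <= size cs)%N.
    apply: uniq_leq_size; first by rewrite map_inj_uniq ?iota_uniq.
    by move=> x /mapP[k _ ->]; have /negP := all_in k; rewrite negbK.
  by rewrite size_map size_iota ltnn.
exists k => v /shift_eq0 Tv; move: (csP v) => {csP}.
elim: cs ckP v Tv => [|d cs IH] //=.
rewrite in_cons negb_or => /andP[kd kcs] v Tv /(IH kcs).
have -> : shift T d v = (c k - d) *: v by rewrite /shift Tv scalerBl.
rewrite linearZ /= Tv !scalerA mulrC => /(_ erefl)/eqP.
by rewrite scaler_eq0 subr_eq0 (negPf kd) => /eqP.
Qed.

(** The powers of [D] shift generalized eigenvectors of [T] along the
    progression [c + k * d], which leaves the finite spectrum of [T]. *)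
Lemma raise_nilpotent (T D : {linear W -> W}) (d c : F) v :
  d != 0 -> (forall w, T (D w) = D (T w) + d *: D w) ->
  shift T c (shift T c v) = 0 -> exists k, iter k D v = 0.
Proof.
move=> d0 TD v0.
have [|k kP] := @eigenvalue_avoid T (fun k => c + k%:R * d).
  by move=> i j /addrI /(mulIf d0) /eqP; rewrite eqr_nat => /eqP.
exists k; do 2!apply: (kP).
elim: k {kP} => [|k IH]; first by rewrite mul0r addr0.
have sD a w : shift T (a + d) (D w) = D (shift T a w).
  by rewrite /shift TD [D (_ - _)]linearB [D (a *: _)]linearZ_LR; module.
by rewrite -natr1 mulrDl mul1r addrA iterS !sD IH linear0.
Qed.

(** The subspace is given by a predicate [Q], since in the application it is
    the set of common solutions of many eigenvalue equations.  The proof strips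
    off one factor [T - c] of an annihilating product at a time: the part of
    [(T - c) v] off the eigenvalue [c] has an explicit preimage [u], and
    [v - u] is an eigenvector because [T] has no Jordan block at [c]. *)
Lemma eigen_sum (T : {linear W -> W}) (Q : W -> Prop) v :
  semisimple_op T ->
  (forall a u w, Q u -> Q w -> Q (a *: u + w)) -> (forall w, Q w -> Q (T w)) ->
  Q v -> vec_sum (fun w => Q w /\ exists c, T w = c *: w) v.
Proof.
move=> Tss Qlin QT; have [cs /(_ v)] := op_annihilated T.
suff main : foldl (fun w c => shift T c w) v cs = 0 -> Q v ->
    exists2 s : seq (F * W), (forall p, p \in s -> Q p.2 /\ T p.2 = p.1 *: p.2) &
      v = \sum_(p <- s) p.2.
  move=> /main{}main /main[s sP ->]; exists (map snd s); last by rewrite big_map.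
  by move=> w /mapP[p /sP[Qp Tp] ->]; split; last exists p.1.
have Q0 w : Q w -> Q 0.
  by move=> Qw; have := Qlin (-1) w w Qw Qw; rewrite scaleN1r addNr.
have QZ a w : Q w -> Q (a *: w).
  by move=> Qw; rewrite -[_ *: _]addr0; apply: Qlin => //; apply: Q0 Qw.
elim: cs v => [|c cs IH] v /=.
  by move=> -> _; exists [::] => //; rewrite big_nil.
move=> v0 Qv.
have Qs : Q (shift T c v).
  by rewrite /shift addrC -scaleNr; apply: Qlin => //; apply: QT.
have [s sP vE] := IH _ v0 Qs.
pose s1 := [seq (p.1, (p.1 - c)^-1 *: p.2) | p <- s & p.1 != c].
pose u := \sum_(p <- s1) p.2.
have s1P p : p \in s1 -> Q p.2 /\ T p.2 = p.1 *: p.2.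
  case/mapP=> q; rewrite mem_filter => /andP[_ /sP[Qq Tq]] -> /=.
  by split; [apply: QZ | rewrite linearZ /= Tq !scalerA mulrC].
have Qu : Q u.
  rewrite /u big_seq; apply: big_ind => [|x y Qx Qy|p /s1P[]//].
    exact: Q0 Qv.
  by rewrite -[x]scale1r; apply: Qlin.
have QB : Q (v - u) by rewrite addrC -scaleN1r; apply: Qlin.
have su : shift T c u = \sum_(p <- s | p.1 != c) p.2.
  rewrite /u linear_sum big_map big_filter big_seq_cond [RHS]big_seq_cond.
  apply: eq_bigr => p /andP[/sP[_ Tp] pc].
  transitivity (((p.1 - c)^-1 * (p.1 - c)) *: p.2); last first.
    by rewrite mulVf ?scale1r // subr_eq0.
  by rewrite /= /shift linearZ /= Tp; module.
have svu : shift T c (v - u) = \sum_(p <- s | p.1 == c) p.2.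
  rewrite linearB /= su vE; apply/eqP; rewrite subr_eq; apply/eqP.
  by rewrite (bigID (fun p => p.1 == c)).
have Tvu : T (v - u) = c *: (v - u).
  apply/shift_eq0/Tss; rewrite svu linear_sum big_seq_cond big1 // => p.
  by case/andP=> /sP[_ Tp] /eqP pc; rewrite /= /shift Tp pc subrr.
exists ((c, v - u) :: s1) => [p|]; last by rewrite big_cons /= subrK.
by rewrite in_cons => /predU1P[->|/s1P].
Qed.

Lemma vec_sum_bind (P Q : W -> Prop) v :
  (forall w, P w -> vec_sum Q w) -> vec_sum P v -> vec_sum Q v.
Proof.
move=> PQ [s sP ->]; elim: s sP => [|w s IH] sP.
  by exists [::] => //; rewrite !big_nil.
have [|s' s'P E] := IH; first by move=> x xs; apply: sP; rewrite in_cons xs orbT.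
have [|t tP E'] := PQ w; first by apply: sP; rewrite in_cons eqxx.
exists (t ++ s') => [x|]; last by rewrite big_cat big_cons /= -E' -E.
by rewrite mem_cat => /orP[/tP|/s'P].
Qed.

(** Commuting semisimple operators are simultaneously diagonalizable: each
    operator preserves the joint eigenspaces of the others. *)
Lemma joint_eigen_sum (I : eqType) (T : I -> {linear W -> W}) (r : seq I) v :
  {in r &, forall i j w, T i (T j w) = T j (T i w)} ->
  {in r, forall i, semisimple_op (T i)} ->
  vec_sum (fun w => {in r, forall i, exists c, T i w = c *: w}) v.
Proof.
elim: r => [|i r IH] TC Tss.
  by exists [:: v] => //; rewrite big_cons big_nil addr0.
have ir : i \in i :: r by rewrite inE eqxx.
have sub j : j \in r -> j \in i :: r by rewrite inE orbC => ->.
apply: vec_sum_bind (IH _ _); first last.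
- by move=> j /sub; apply: Tss.
- by move=> j k /sub jr /sub kr; apply: TC.
move=> w wr.
pose Q u := {in r, forall j c, T j w = c *: w -> T j u = c *: u}.
have /vec_sum_bind : vec_sum (fun u => Q u /\ exists c, T i u = c *: u) w.
  apply: eigen_sum => //.
  - exact: Tss.
  - move=> a x y Qx Qy j jr c Tw.
    by rewrite linearP (Qx j jr c) // (Qy j jr c) // scalerDr !scalerA mulrC.
  - move=> x Qx j jr c Tw.
    by rewrite TC ?(Qx j jr c) ?linearZ //; apply: sub.
apply=> x [Qx [c Tx]]; exists [:: x]; last by rewrite big_cons big_nil addr0.
move=> y; rewrite inE => /eqP-> j; rewrite inE => /predU1P[->|jr]; first by exists c.
by have [d Tw] := wr j jr; exists d; apply: Qx.
Qed.

End LinearOperators.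

(** * Modules over sl2 *)

Section Sl2.
Variables (F : numClosedFieldType) (W : vectType F).

Lemma iter_linear (D : {linear W -> W}) n : linear (iter n D).
Proof. by move=> a u v; elim: n => //= n ->; rewrite linearP. Qed.

HB.instance Definition _ (D : {linear W -> W}) n :=
  GRing.isLinear.Build F W W _ (iter n D) (iter_linear D n).

(** The commutation relations of a raising operator [E], a lowering operator
    [D] and [T = [E, D]].  The case [a = 1] is sl2 and the case [a = 0] is the
    Heisenberg algebra. *)
Section Relation.
Variables (E D T : {linear W -> W}) (a : F).
Hypothesis ED : forall w, E (D w) = D (E w) + T w.
Hypothesis TD : forall w, T (D w) = D (T w) - (2 * a) *: D w.

Lemma weight_iter_lower v n :
  T (iter n D v) = iter n D (T v) - (n%:R * (2 * a)) *: iter n D v.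
Proof.
elim: n => [|n IH] /=; first by rewrite mul0r scale0r subr0.
by rewrite TD IH (linearB D) (linearZ_LR D) -[n.+1%:R]natr1; module.
Qed.

Lemma raise_iter_lower v n : E v = 0 ->
  E (iter n.+1 D v) = n.+1%:R *: iter n D (shift T (n%:R * a) v).
Proof.
move=> Ev; rewrite /shift linearB linearZ.
elim: n => [|n IH] /=; first by rewrite ED Ev linear0 -[1%:R]/1; module.
rewrite ED -[D (iter n D v)]/(iter n.+1 D v) IH weight_iter_lower.
rewrite (linearZ_LR D) (linearB D) (linearZ_LR D).
by rewrite -[n.+2%:R]natr1 -[n.+1%:R]natr1 /=; module.
Qed.

(** If [N] is minimal with [D^N v = 0], then applying [E] gives
    [N (c - (N - 1) a) D^(N-1) v = 0]. *)
Lemma top_vector_eigenvalue v c N :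
  E v = 0 -> T v = c *: v -> iter N D v = 0 -> v != 0 ->
  exists2 n, (n < N)%N & c = n%:R * a.
Proof.
move=> Ev Tv + v0; elim: N => [/= v00|N IH DN]; first by rewrite v00 eqxx in v0.
have [cE|cN] := eqVneq c (N%:R * a); first by exists N.
have [|n nN cE] := IH; last by exists n; rewrite // ltnS ltnW.
have := raise_iter_lower N Ev; rewrite DN linear0 => /esym/eqP.
have -> : shift T (N%:R * a) v = (c - N%:R * a) *: v.
  by rewrite /shift Tv scalerBl.
by rewrite linearZ !scaler_eq0 pnatr_eq0 /= subr_eq0 (negPf cN) => /eqP.
Qed.

(** Iterating [raise_iter_lower], some product of the distinct factors
    [T - n a] with [n < N] kills [v]; hence [T] has no Jordan block there. *)
Lemma top_vector_semisimple v c N :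
  a != 0 -> (forall w, E w = 0 -> E (T w) = 0) ->
  E v = 0 -> iter N D v = 0 ->
  shift T c (shift T c v) = 0 -> shift T c v = 0.
Proof.
move=> a0 ET; elim: N v => [v _ /= -> _|N IH v Ev DN Tv]; first by rewrite linear0.
have := raise_iter_lower N Ev; rewrite DN linear0 => /esym/eqP.
rewrite scaler_eq0 pnatr_eq0 /= => /eqP DN'.
have shiftC b d w : shift T b (shift T d w) = shift T d (shift T b w).
  by rewrite /shift !(linearB T) !(linearZ_LR T); module.
have Esh b w : E w = 0 -> E (shift T b w) = 0.
  by move=> Ew; rewrite linearB linearZ /= ET // Ew scaler0 subr0.
have Tcu : shift T c (shift T (N%:R * a) v) = 0.
  by apply: IH; rewrite ?Esh // !(shiftC c (N%:R * a)) Tv linear0.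
have [cE|cN] := eqVneq c (N%:R * a).
  rewrite -cE in DN'; apply/eqP/negPn/negP => w0.
  have /shift_eq0 Tw := Tv.
  have [n nN] := top_vector_eigenvalue (Esh c v Ev) Tw DN' w0.
  by rewrite cE => /(mulIf a0)/eqP; rewrite eqr_nat => /eqP NE; rewrite NE ltnn in nN.
rewrite shiftC in Tcu; move/shift_eq0: Tcu; move/shift_eq0: Tv => -> /eqP.
by rewrite -subr_eq0 -scalerBl scaler_eq0 subr_eq0 (negPf cN) => /eqP.
Qed.
End Relation.

Section Triple.
Variables E D H : {linear W -> W}.
Hypothesis HE : forall w, H (E w) = E (H w) + 2 *: E w.
Hypothesis HD : forall w, H (D w) = D (H w) - 2 *: D w.
Hypothesis ED : forall w, E (D w) = D (E w) + H w.

Let HD1 w : H (D w) = D (H w) - (2 * 1) *: D w. Proof. by rewrite mulr1. Qed.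

Lemma lower_nilpotent v c :
  shift H c (shift H c v) = 0 -> exists N, iter N D v = 0.
Proof.
apply: (@raise_nilpotent _ _ H D (- 2)); first by rewrite oppr_eq0 pnatr_eq0.
by move=> w; rewrite HD scaleNr.
Qed.

Lemma highest_weight_nat v c :
  E v = 0 -> H v = c *: v -> v != 0 -> exists n, c = n%:R.
Proof.
move=> Ev Hv v0; have [|N DN] := @lower_nilpotent v c.
  by rewrite (proj2 (shift_eq0 _ _ _) Hv) linear0.
have [n _ ->] := top_vector_eigenvalue ED HD1 Ev Hv DN v0.
by exists n; rewrite mulr1.
Qed.

(** Induction on the exponent [n] with [E^n v = 0].  For [n = 1] this is
    [top_vector_semisimple].  In general, if [v] generated a Jordan block, the
    induction hypothesis for [E v] would make [w = (H - c) v] a highest weight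
    vector, so that [c] is a natural number.  The Casimir operator [C] commutes
    with [E] and [H]; subtracting its value [b] at the highest weight
    [c + 2 (n - 1)], which is the weight of [E^(n-1) v], lowers [n].  So the
    induction hypothesis gives [(C - b) w = 0], whereas [C] takes another value
    on [w]. *)
Lemma sl2_semisimple : semisimple_op H.
Proof.
move=> c v Hv.
have [|k] := @raise_nilpotent _ _ H E 2 c v _ HE Hv; first by rewrite pnatr_eq0.
have sE b w : shift H (b + 2) (E w) = E (shift H b w).
  by rewrite /shift HE [E (_ - _)]linearB [E (b *: _)]linearZ_LR; module.
have base b w : E w = 0 -> shift H b (shift H b w) = 0 -> shift H b w = 0.
  move=> Ew Hw; have [N DN] := lower_nilpotent Hw.
  apply: (top_vector_semisimple ED HD1 (oner_neq0 _) _ Ew DN Hw) => u Eu.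
  by apply/eqP; have /eqP := HE u; rewrite Eu linear0 scaler0 addr0 eq_sym.
elim: k c v Hv => [c v _ /= ->|k IH c v Hv]; first by rewrite linear0.
case: k IH => [_ Ev|k IH Ev]; first exact: base.
set w := shift H c v.
have Ew : E w = 0.
  rewrite -sE; apply: IH; last by rewrite -iterSr.
  by rewrite !sE Hv linear0.
apply/eqP/negPn/negP => w0.
have Hw : H w = c *: w by apply/shift_eq0.
have [m cE] := highest_weight_nat Ew Hw w0.
have lin3 := (HE, HD, ED, linearD H, linearD E, linearD D,
  linearN H, linearN E, linearN D, linearZ_LR H, linearZ_LR E, linearZ_LR D).
pose C u := H (H u) + 2 *: H u + 4 *: D (E u).
(* the value of the Casimir operator on a highest weight vector of weight
   c + 2 (k + 1) *)
pose b : F := (c + 2 * k.+1%:R) * (c + 2 * k.+1%:R + 2).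
have CB x r y : C (x - r *: y) = C x - r *: C y.
  by rewrite /C !lin3; module.
have CE u : C (E u) = E (C u).
  by rewrite /C !lin3; module.
have CH u : C (H u) = H (C u).
  by rewrite /C !lin3; module.
have HC d u : shift H d (shift C b u) = shift C b (shift H d u).
  by rewrite /shift CB CH [H (_ - _)]linearB [H (b *: _)]linearZ_LR; module.
have Ckv : shift C b w = 0.
  rewrite -HC; apply: IH; first by rewrite !HC Hv /shift /C !linear0; module.
  have iterC n u : iter n E (shift C b u) = shift C b (iter n E u).
    by elim: n => //= n ->; rewrite /shift CE (linearB E) (linearZ_LR E).
  rewrite iterC; set u := iter k.+1 E v.
  have Hu : H u = (c + 2 * k.+1%:R) *: u.
    apply/shift_eq0; apply: base; first exact: Ev.
    have iterH n x d : shift H (d + 2 * n%:R) (iter n E x) = iter n E (shift H d x).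
      elim: n => [|n IHn]; first by rewrite mulr0 addr0.
      by rewrite -[n.+1%:R]natr1 mulrDr mulr1 addrA !iterS sE IHn.
    by rewrite !iterH Hv linear0.
  have Eu : E u = 0 by [].
  by rewrite /shift /C Eu linear0 Hu linearZ_LR Hu /b; module.
move: Ckv; rewrite /shift /C Ew linear0 Hw linearZ_LR Hw => /eqP.
have -> : c *: (c *: w) + 2 *: (c *: w) + 4 *: 0 - b *: w =
    - (4 * (k.+1%:R * (m + k.+2)%:R)) *: w.
  by rewrite /b cE natrD -[k.+2%:R]natr1; module.
by rewrite scaler_eq0 (negPf w0) orbF oppr_eq0 -natrM mulf_eq0 !pnatr_eq0 /= addnS.
Qed.
End Triple.

End Sl2.

(** The symmetry [(E, H, D) |-> (D, - H, E)] of sl2 turns lowest weight vectors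
    into highest weight vectors. *)
Lemma lowest_weight_nat (F : numClosedFieldType) (W : vectType F)
    (E D H : {linear W -> W}) v c :
  (forall w, H (E w) = E (H w) + 2 *: E w) ->
  (forall w, E (D w) = D (E w) + H w) ->
  D v = 0 -> H v = c *: v -> v != 0 -> exists n, c = - n%:R.
Proof.
move=> HE ED Dv Hv v0.
have [|||n cE] := @highest_weight_nat _ _ D E (\- H) _ _ v (- c) Dv _ v0.
- by move=> w /=; rewrite HE linearN; module.
- by move=> w /=; rewrite ED addrK.
- by rewrite /= Hv scaleNr.
by exists n; rewrite -cE opprK.
Qed.

(** * Linear functionals and bilinear forms *)

Lemma span_closed (F : fieldType) (W : vectType F) (P : W -> Prop) (s : seq W) x :
  P 0 -> (forall a u v, P u -> P v -> P (a *: u + v)) ->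
  (forall y, y \in s -> P y) -> x \in <<s>>%VS -> P x.
Proof.
move=> P0 Plin sP; rewrite -[s]/(val (in_tuple s)) => /coord_span->.
apply: big_ind => // [u v Pu Pv|i _]; first by rewrite -[u]scale1r; apply: Plin.
by rewrite -[_ *: _]addr0; apply: Plin => //; apply: sP; apply: mem_nth.
Qed.

Lemma common_zero (F : fieldType) (U : vectType F) n (f : 'I_n -> U -> F) :
  (n < \dim {:U})%N -> (forall i, scalar (f i)) ->
  exists2 x, x != 0 & forall i, f i x = 0.
Proof.
move=> nU flin; pose g x : 'rV[F]_n := \row_i f i x.
have glin : linear g by move=> a x y; apply/rowP => i; rewrite !mxE flin.
pose gL : {linear U -> 'rV[F]_n} := HB.pack g (GRing.isLinear.Build F U _ _ g glin).
have := limg_ker_dim (linfun gL) fullv; rewrite capfv => dimE.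
have kn0 : lker (linfun gL) != 0%VS.
  apply: contraTneq nU => k0; rewrite -leqNgt -dimE k0 dimv0 add0n.
  by apply: leq_trans (dimvS (subvf _)) _; rewrite dimvf /dim /= mul1n.
exists (vpick (lker (linfun gL))); first by rewrite vpick0.
move=> i; have := memv_pick (lker (linfun gL)).
by rewrite memv_ker lfunE => /eqP/rowP/(_ i); rewrite !mxE.
Qed.

(** The equations [b t e_i = c lambda(e_i)] in the unknown [(t, c)] are one
    fewer than the dimension of the space of unknowns, and a nonzero solution
    has [c != 0] because [b] is nondegenerate. *)
Lemma functional_representation (F : fieldType) (U : vectType F)
    (b : U -> U -> F) (lambda : 'Hom(U, F^o)) :
  (forall x, scalar (b x)) -> (forall y, scalar (b^~ y)) ->
  (forall x, (forall y, b x y = 0) -> x = 0) ->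
  exists t, forall y, lambda y = b t y.
Proof.
move=> blinr blinl bnd; pose e := vbasis {:U}.
pose f i (p : (U * F^o)%type) := b p.1 e`_i - p.2 * (lambda e`_i : F).
have [||[t c] /= tc0 tcE] := @common_zero F (U * F^o)%type (\dim {:U}) f.
- by rewrite [X in (_ < X)%N]dimvf dimvf /dim /= addn1.
- by move=> i a [x c] [y d]; rewrite /f /= blinl -[a *: c]/(a * (c : F)); ring.
have tE y : b t y = c * (lambda y : F).
  have /coord_vbasis -> := memvf y.
  rewrite linear_sum mulr_sumr.
  have -> : b t (\sum_(i < \dim {:U}) coord e i y *: e`_i) =
      \sum_(i < \dim {:U}) coord e i y * b t e`_i.
    have b0 : b t 0 = 0 by have := blinr t (-1) 0 0; rewrite scaler0 addr0 mulN1r addNr.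
    apply: (big_ind2 (fun u z => b t u = z)) => // [u z v w <- <-|i _].
      by have := blinr t 1 u v; rewrite scale1r mul1r.
    by have := blinr t (coord e i y) e`_i 0; rewrite addr0 b0 addr0.
  apply: eq_bigr => i _; rewrite linearZ /= /GRing.scale /= mulrCA; congr (_ * _).
  by apply/eqP; rewrite -subr_eq0; apply/eqP/tcE.
have c0 : c != 0.
  apply: contraNneq tc0 => c0; rewrite c0 -pair_eqE /= /pair_eq /= eqxx andbT.
  by apply/eqP/bnd => y; rewrite tE c0 mul0r.
exists (c^-1 *: t) => y; have := blinl y c^-1 t 0; rewrite !addr0 => ->.
have := blinl y (-1) t t.
rewrite scaleN1r addNr mulN1r addNr => ->.
by rewrite addr0 tE mulKf.
Qed.

Lemma last_nonzero (W : zmodType) (D : W -> W) n v :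
  v != 0 -> iter n D v = 0 -> exists2 k, iter k D v != 0 & D (iter k D v) = 0.
Proof.
move=> v0; elim: n => [/= /eqP|n IH Dn]; first by rewrite (negPf v0).
by have [/IH//|Dn0] := eqVneq (iter n D v) 0; exists n.
Qed.

(** * Weight vectors *)

Section LieModule.
Variables (F : numClosedFieldType) (g W : vectType F) (h : {vspace g}).
Variables (br : {bilinear g -> g -> g}) (act : {bilinear g -> W -> W}).
Hypothesis act_module : lie_module br act.
Implicit Types (lambda mu alpha : 'Hom(subvs_of h, F^o)) (X Y : g) (v w : W).

Lemma actC X Y v : act X (act Y v) = act Y (act X v) + act (br X Y) v.
Proof. by rewrite act_module addrC subrK. Qed.

Lemma weight_space0 lambda : weight_space act lambda 0.
Proof. by move=> H; rewrite linear0 scaler0. Qed.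

Lemma weight_spaceP lambda a v w :
  weight_space act lambda v -> weight_space act lambda w ->
  weight_space act lambda (a *: v + w).
Proof. by move=> Wv Ww H; rewrite linearP /= Wv Ww /= scalerDr !scalerA mulrC. Qed.

Lemma weight_spaceZ lambda a v :
  weight_space act lambda v -> weight_space act lambda (a *: v).
Proof.
by move=> Wv; rewrite -[_ *: _]addr0; apply: weight_spaceP (weight_space0 _).
Qed.

Lemma weight_act alpha lambda X v :
  weight_space br alpha X -> weight_space act lambda v ->
  weight_space act (lambda + alpha) (act X v).
Proof.
move=> WX Wv H; rewrite actC Wv WX linearZl_LR linearZr_LR -scalerDl.
by rewrite add_lfunE.
Qed.

Lemma weight_iter alpha lambda X v n :
  weight_space br alpha X -> weight_space act lambda v ->
  exists mu, weight_space act mu (iter n (act X) v).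
Proof.
move=> WX Wv; elim: n => [|n [mu IH]]; first by exists lambda.
by exists (mu + alpha); apply: weight_act.
Qed.

(** The functional is read off a coordinate in which [v] does not vanish. *)
Lemma joint_eigen_weight (r : seq (subvs_of h)) v : <<r>>%VS = fullv ->
  {in r, forall H, exists c, act (vsval H) v = c *: v} ->
  exists lambda, weight_space act lambda v.
Proof.
move=> r_span rv; have [->|v0] := eqVneq v 0.
  by exists 0; apply: weight_space0.
have hv (H : subvs_of h) : exists c, act (vsval H) v = c *: v.
  have : H \in <<r>>%VS by rewrite r_span memvf.
  apply: span_closed rv; first by exists 0; rewrite linear0 linear0l scale0r.
  move=> a X Y [c Xv] [d Yv]; exists (a * c + d).
  by rewrite linearP linearPl Xv Yv /= scalerA scalerDl.
have [i vi0] : exists i, v2r v 0 i != 0.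
  apply/existsP; rewrite -negb_forall; apply: contra v0 => /forallP vi.
  apply/eqP/v2r_inj/rowP => i; rewrite linear0 mxE; exact/eqP/vi.
pose l (H : subvs_of h) : F^o := v2r (act (vsval H) v) 0 i / v2r v 0 i.
have llin : linear l.
  move=> a X Y; rewrite /l linearP linearPl linearP !mxE mulrDl.
  by rewrite /GRing.scale /= mulrA.
pose lL : {linear subvs_of h -> F^o} :=
  HB.pack l (GRing.isLinear.Build F (subvs_of h) F^o _ l llin).
exists (linfun lL) => H; rewrite lfunE /= /l.
by have [c ->] := hv H; rewrite linearZ_LR mxE mulfK.
Qed.

Lemma weight_decomposition (r : seq (subvs_of h)) v :
  lie_abelian br h -> <<r>>%VS = fullv ->
  {in r, forall H, semisimple_op (act (vsval H))} ->
  vec_sum (fun w => exists lambda, weight_space act lambda w) v.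
Proof.
move=> h_ab r_span r_ss.
apply: (vec_sum_bind _ (@joint_eigen_sum _ _ _ (fun H => act (vsval H)) r v _ r_ss)).
- move=> w /(joint_eigen_weight r_span) Ww.
  by exists [:: w]; [move=> u; rewrite inE => /eqP-> | rewrite big_seq1].
- by move=> X Y _ _ w /=; rewrite actC h_ab ?subvsP // linear0l addr0.
Qed.

End LieModule.

Section InvariantForm.
Variables (F : numClosedFieldType) (g W : vectType F) (h : {vspace g}).
Variables (act : {bilinear g -> W -> W}) (b : {biscalar W}).
Hypothesis b_inv : forall X v w, b (act X v) w + b v (act X w) = 0.
Implicit Types (lambda mu : 'Hom(subvs_of h, F^o)).

(** Weight spaces are orthogonal unless their weights are opposite. *)
Lemma form_weights lambda mu v w :
  weight_space act lambda v -> weight_space act mu w -> b v w != 0 ->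
  mu = - lambda.
Proof.
move=> Wv Ww bvw; apply/lfunP => H; rewrite opp_lfunE; apply/eqP.
rewrite -addr_eq0; have /eqP := b_inv (vsval H) v w.
rewrite Wv Ww linearZl_LR linearZr_LR /= -mulrDl mulf_eq0 (negPf bvw) orbF.
by rewrite addrC.
Qed.

(** As [b] is nondegenerate, some weight component of some vector pairs
    nontrivially with [v], and only the weight [- lambda] can contribute. *)
Lemma form_pairing lambda v :
  (forall x, (forall y, b x y = 0) -> x = 0) ->
  (forall w, vec_sum (fun w => exists mu, weight_space (h := h) act mu w) w) ->
  weight_space act lambda v -> v != 0 ->
  exists2 w, weight_space act (- lambda) w & b v w != 0.
Proof.
move=> b_nd dec Wv; apply: contra_neqP => nw; apply: b_nd => y.
have [s sP ->] := dec y; rewrite linear_sumr big_seq big1 // => w /sP[mu Ww].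
apply/eqP/negPn/negP => bvw; apply: nw; exists w => //.
by rewrite -(form_weights Wv Ww bvw).
Qed.

End InvariantForm.

(** * Semisimple Lie algebras with an invariant form *)

Section Cartan.
Variables (F : numClosedFieldType) (g : vectType F) (br : {bilinear g -> g -> g}).
Variables (h : {vspace g}) (b : {biscalar g}).
Hypothesis br_lie : lie_bracket br.
Hypothesis br_semisimple : lie_semisimple br.
Hypothesis h_cartan : cartan_subalgebra br h.
Hypothesis b_sym : forall X Y, b X Y = b Y X.
Hypothesis b_inv : forall X Y Z, b (br X Y) Z + b Y (br X Z) = 0.
Hypothesis b_nd : forall X, (forall Y, b X Y = 0) -> X = 0.
Implicit Types (X Y Z : g) (H T : subvs_of h) (alpha lambda mu : 'Hom(subvs_of h, F^o)).

Lemma brC X Y : br X Y = - br Y X.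
Proof.
have [br0 _] := br_lie; apply/eqP; rewrite -addr_eq0.
have := br0 (X + Y); rewrite linearDl !linearDr !br0 add0r addr0.
by move=> ->.
Qed.

Lemma adjoint_module : lie_module br br.
Proof.
have [_ J] := br_lie; move=> X Y Z.
apply/eqP; rewrite eq_sym subr_eq addrC -subr_eq0; apply/eqP.
rewrite -[RHS](J X Y Z) (brC Z (br X Y)) (brC Z X) linearNr.
by rewrite opprD addrA addrAC.
Qed.

Lemma brACA X Y Z : br X (br Y Z) = br Y (br X Z) + br (br X Y) Z.
Proof. exact: (actC adjoint_module). Qed.

Lemma b_move X Y Z : b (br X Y) Z = - b Y (br X Z).
Proof. by apply/eqP; rewrite -addr_eq0 b_inv. Qed.

Lemma cartan_abelian : lie_abelian br h. Proof. by case: h_cartan. Qed.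

(** Otherwise [h + <[X]>] would be a larger abelian subalgebra. *)
Lemma cartan_centralizer X : (forall H, br (vsval H) X = 0) -> X \in h.
Proof.
move=> hX; have [h_ab h_max _] := h_cartan; have [br0 _] := br_lie.
have hX' Y : Y \in h -> br Y X = 0.
  by move=> Yh; have := hX (Subvs Yh).
rewrite -(h_max (h + <[X]>)%VS) ?addvSl //.
  by apply: (subvP (addvSr h <[X]>)); rewrite memv_line.
move=> _ _ /memv_addP[Y Yh [_ /vlineP[c ->] ->]] /memv_addP[Z Zh [_ /vlineP[d ->] ->]].
rewrite linearDl !linearDr h_ab // !linearZl_LR !linearZr_LR hX' // br0 brC hX' //.
by rewrite oppr0 !scaler0 !addr0.
Qed.

Lemma weight0_cartan X : weight_space br (0 : 'Hom(subvs_of h, F^o)) X <-> X \in h.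
Proof.
split=> [X0|Xh H]; last by rewrite cartan_abelian ?subvsP // lfunE /= scale0r.
by apply: cartan_centralizer => H; rewrite X0 lfunE /= scale0r.
Qed.

Lemma diagonalizable_semisimple (f : {linear g -> g}) :
  diagonalizable_endo f -> semisimple_op f.
Proof.
move=> [e e_basis eP] c v.
have e_free := basis_free e_basis; rewrite -[e]/(val (in_tuple e)) in e_basis e_free.
have fco i : exists d, forall w,
    coord (in_tuple e) i (f w) = d * coord (in_tuple e) i w.
  have [|d fe] := eP e`_i; first exact: mem_nth.
  exists d => w; have /(coord_basis e_basis) {1}-> := memvf w.
  rewrite !linear_sum /= (bigD1 i) //= big1 => [|j ji].
    rewrite addr0 !linearZ /= fe linearZ /= (coord_free _ _ e_free) eqxx.
    by rewrite !mulr1 mulrC.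
  have [|d' fe'] := eP e`_j; first exact: mem_nth.
  rewrite !linearZ /= fe' linearZ /= (coord_free _ _ e_free).
  by rewrite (negPf ji) !mulr0.
move=> v0; have /(coord_basis e_basis) -> := memvf (shift f c v).
apply: big1 => i _; have [d fd] := fco i.
have sco w : coord (in_tuple e) i (shift f c w) = (d - c) * coord (in_tuple e) i w.
  by rewrite linearB linearZ /= fd mulrBl.
have := congr1 (coord (in_tuple e) i) v0; rewrite linear0 !sco => /eqP.
rewrite mulf_eq0 => /orP[] /eqP E; last by rewrite E scale0r.
by rewrite E mul0r scale0r.
Qed.

(** A line in the centre is a solvable ideal. *)
Lemma no_center H : (forall X, br (vsval H) X = 0) -> H = 0.
Proof.
move=> HX; have I0 : <[vsval H]>%VS = 0%VS; last first.
  by apply/val_inj/eqP; rewrite /= -memv0 -I0 memv_line.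
have XH X c : br X (c *: vsval H) = 0.
  by rewrite linearZr_LR brC HX oppr0 scaler0.
apply: br_semisimple => [X Y /vlineP[c ->]|]; first by rewrite XH mem0v.
exists 1%N; apply/seteqP; split=> X /=; last first.
  by move=> ->; exists [::]; rewrite // mem0v.
case=> s sP; apply: (@span_closed _ _ (fun x => x = 0)) => //= [a u v -> ->|Y /sP].
  by rewrite scaler0 addr0.
by case=> A _ [B /= /vlineP[c ->] <-].
Qed.

Lemma adjoint_decomposition X :
  vec_sum (fun Y => exists alpha, weight_space br alpha Y) X.
Proof.
apply: (weight_decomposition adjoint_module (r := vbasis fullv)) => //.
- exact: cartan_abelian.
- by apply: span_basis; apply: vbasisP.
- move=> H _; apply: diagonalizable_semisimple.
  by have [_ _] := h_cartan; apply; apply: subvsP.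
Qed.

(** The Cartan subalgebra is the zero weight space, hence paired with itself. *)
Lemma form_cartan_nd H : (forall T, b (vsval H) (vsval T) = 0) -> H = 0.
Proof.
move=> bH; apply/eqP/negPn/negP => H0.
have WH : weight_space br (0 : 'Hom(subvs_of h, F^o)) (vsval H).
  exact/weight0_cartan/subvsP.
have [|X] := form_pairing b_inv b_nd adjoint_decomposition WH.
  by apply: contra H0 => /eqP H0; apply/eqP/val_inj.
rewrite oppr0 => /weight0_cartan Xh.
by rewrite -[X]/(vsval (Subvs Xh)) bH eqxx.
Qed.

(** Existence of the vectors [t_lambda]. *)
Lemma weight_representation lambda :
  exists T, forall H, lambda H = b (vsval T) (vsval H).
Proof.
apply: functional_representation form_cartan_nd => [H|H] a X Y /=.
  by rewrite linearDr linearZr_LR.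
by rewrite linearDl linearZl_LR.
Qed.

Lemma bracket_opposite alpha T X Y :
  (forall H, alpha H = b (vsval T) (vsval H)) ->
  weight_space br alpha X -> weight_space br (- alpha) Y ->
  br X Y = b X Y *: vsval T.
Proof.
move=> TE WX WY.
have : weight_space br (0 : 'Hom(subvs_of h, F^o)) (br X Y).
  by rewrite -(addNr alpha); apply: (weight_act adjoint_module).
move/weight0_cartan => XYh; apply/eqP; rewrite -subr_eq0.
have Zh : br X Y - b X Y *: vsval T \in h by rewrite rpredB ?rpredZ ?subvsP.
suff: Subvs Zh = 0 by move/(congr1 vsval) => /= ->.
apply: form_cartan_nd => H /=.
rewrite linearBl linearZl_LR /= -TE b_move brC WX linearNr opprK linearZr_LR /=.
by rewrite [b Y X]b_sym mulrC subrr.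
Qed.

(** If [alpha T] vanished, root vectors [e], [f] of opposite roots and
    [Z = [e, f]], a nonzero multiple of [T], would satisfy the Heisenberg
    relations.  Both [e] and [f] act nilpotently on weight vectors, since they
    shift weights by multiples of [alpha], so [Z] cannot act by a nonzero
    scalar on any of them.  Then [T] would be central. *)
Lemma form_root_nonisotropic alpha T :
  is_root br alpha -> (forall H, alpha H = b (vsval T) (vsval H)) ->
  alpha T != 0 :> F.
Proof.
move=> [alpha0 [e We e0]] TE; apply/negP => /eqP alphaT.
have [f Wf bef] := form_pairing b_inv b_nd adjoint_decomposition We e0.
have efT := bracket_opposite TE We Wf.
have [H0 aH0] : exists H, alpha H != 0 :> F.
  apply/not_existsP => aH; case/eqP: alpha0; apply/lfunP => H.
  by rewrite lfunE /=; apply/eqP/negPn/negP => /aH.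
have T0 lambda x : weight_space br lambda x -> br (vsval T) x = 0.
  move=> Wx; rewrite Wx; apply/eqP; rewrite scaler_eq0 orbC.
  apply/orP; have [x0|x0] := eqVneq x 0; [by left | right].
  have eN y mu : weight_space br mu y -> exists n, iter n (br e) y = 0.
    move=> Wy.
    apply: (@raise_nilpotent _ _ (br (vsval H0)) (br e) (alpha H0) (mu H0)) => //.
      by move=> w /=; rewrite brACA We linearZl_LR.
    by rewrite (proj2 (shift_eq0 _ _ _) (Wy H0)) linear0.
  have fN y mu : weight_space br mu y -> exists n, iter n (br f) y = 0.
    move=> Wy.
    apply: (@raise_nilpotent _ _ (br (vsval H0)) (br f)
              (- alpha H0) (mu H0)) => //.
    - by rewrite oppr_eq0.
    - by move=> w /=; rewrite brACA Wf linearZl_LR opp_lfunE.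
    by rewrite (proj2 (shift_eq0 _ _ _) (Wy H0)) linear0.
  (* y is killed by e, and T acts on it by the same scalar as on x because
     alpha T = 0 *)
  have [n /(last_nonzero x0)[k y0 ey]] := eN _ _ Wx.
  set y := iter k _ x in y0 ey.
  have [mu Wy] : exists mu, weight_space br mu y.
    exact: (weight_iter adjoint_module) We Wx.
  have Ty : br (vsval T) y = lambda T *: y.
    rewrite /y; elim: (k) => [|j IH]; first exact: Wx.
    by rewrite iterS brACA IH We alphaT scale0r linear0l addr0 linearZr_LR.
  have [N fy] := fN _ _ Wy.
  pose Z := b e f *: vsval T.
  have Zy : br Z y = (b e f * lambda T) *: y by rewrite linearZl_LR Ty scalerA.
  have ef w : br e (br f w) = br f (br e w) + br Z w by rewrite brACA efT.
  have Zf w : br Z (br f w) = br f (br Z w) - (2 * 0) *: br f w.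
    rewrite mulr0 scale0r subr0 brACA [br Z f]linearZl_LR /= Wf opp_lfunE alphaT.
    by rewrite oppr0 scale0r scaler0 linear0l addr0.
  have [m _ /eqP] := top_vector_eigenvalue ef Zf ey Zy fy y0.
  by rewrite mulr0 mulf_eq0 (negPf bef).
have TX X : br (vsval T) X = 0.
  have [s sP ->] := adjoint_decomposition X.
  by rewrite linear_sumr big_seq big1 // => x /sP[lambda /T0].
by case/eqP: aH0; rewrite TE (no_center TX) linear0 linear0l.
Qed.

Definition sl2_triple (e X f : g) : Prop :=
  [/\ br X e = 2 *: e, br X f = - (2 *: f) & br e f = X].

(** The middle element [H] is [2 / alpha t_alpha] times [t_alpha]; the last
    clause records that it is proportional to [t_alpha]. *)
Lemma root_sl2_triple alpha e f :
  is_root br alpha -> weight_space br alpha e -> weight_space br (- alpha) f ->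
  b e f != 0 ->
  exists c H, [/\ sl2_triple (c *: e) (vsval H) f, alpha H = 2 :> F &
    forall T, b (vsval H) (vsval T) = 0 -> alpha T = 0 :> F].
Proof.
move=> ralpha We Wf bef; have [T TE] := weight_representation alpha.
have aT := form_root_nonisotropic ralpha TE.
have aH : alpha ((2 / alpha T) *: T) = 2 :> F.
  have -> : alpha ((2 / alpha T) *: T) = 2 / alpha T * alpha T :> F by rewrite linearZ.
  by rewrite divfK.
exists (2 / (alpha T * b e f)), ((2 / alpha T) *: T); split=> //.
  split.
  - by rewrite linearZr_LR We aH scalerA mulrC -scalerA.
  - by rewrite Wf opp_lfunE aH scaleNr.
  - rewrite linearZl_LR (bracket_opposite TE We Wf) linearZ /= scalerA.
    by congr (_ *: _); field; rewrite aT bef.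
move=> S; rewrite linearZ linearZl_LR /= -TE => /eqP.
rewrite !mulf_eq0 invr_eq0 (negPf aT) pnatr_eq0 /=; exact/eqP.
Qed.

(** The component [x] of [e'] orthogonal to [f] commutes with [f], by
    [bracket_opposite]; it would be a lowest weight vector of weight 2. *)
Lemma root_space_line alpha e e' :
  is_root br alpha -> weight_space br alpha e -> weight_space br alpha e' ->
  e != 0 -> exists c, e' = c *: e.
Proof.
move=> ralpha We We' e0.
have [f Wf bef] := form_pairing b_inv b_nd adjoint_decomposition We e0.
have [c [H [[He Hf ef] aH _]]] := root_sl2_triple ralpha We Wf bef.
have [T TE] := weight_representation alpha.
pose d := b e' f / b e f; exists d; apply/eqP; rewrite -subr_eq0.
apply/negPn/negP => x0; set x := _ - _ in x0.
have Wx : weight_space br alpha x.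
  by rewrite /x addrC -scaleNr; apply: weight_spaceP.
have fx : br f x = 0.
  rewrite brC (bracket_opposite TE Wx Wf) linearBl linearZl_LR /= divfK //.
  by rewrite subrr scale0r oppr0.
have [|||n /eqP] := @lowest_weight_nat _ _ (br (c *: e)) (br f) (br (vsval H))
                      x 2 _ _ fx _ x0.
- by move=> w /=; rewrite brACA He [br (2 *: _) w]linearZl_LR.
- by move=> w /=; rewrite brACA ef.
- by rewrite /= Wx aH.
by rewrite -addr_eq0 -natrD pnatr_eq0.
Qed.

(** As long as coroots do not span h, some nonzero [T] is orthogonal to all of
    them.  It is not central, hence [alpha T != 0] for some root [alpha], and
    the coroot of [alpha] is independent of the previous ones. *)
Lemma coroots_span :
  exists2 r : seq (subvs_of h), <<r>>%VS = fullv &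
    {in r, forall H, exists e f, sl2_triple e (vsval H) f}.
Proof.
suff main n : (n <= \dim {:subvs_of h})%N -> exists r : seq (subvs_of h),
    [/\ size r = n, free r & {in r, forall H, exists e f, sl2_triple e (vsval H) f}].
  have [r [r_size r_free rP]] := main _ (leqnn _).
  exists r => //; apply: span_basis; rewrite basisEfree r_free subvf /=.
  by rewrite r_size.
elim: n => [|n IH] nh; first by exists [::]; rewrite nil_free.
have [r [r_size r_free rP]] := IH (ltnW nh).
have [||T T0 rT] := @common_zero F (subvs_of h) n (fun i T => b (vsval r`_i) (vsval T)).
- exact: nh.
- by move=> i a X Y /=; rewrite linearDr linearZr_LR.
have [alpha [e [We aT e0]]] : exists alpha e,
    [/\ weight_space br alpha e, alpha T != 0 :> F & e != 0].
  apply/not_existsP => nT; case/eqP: T0; apply: no_center => X.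
  have [s sP ->] := adjoint_decomposition X.
  rewrite linear_sumr big_seq big1 // => x /sP[lambda Wx].
  apply/eqP/negPn/negP; rewrite Wx scaler_eq0 negb_or => /andP[lT x0].
  by case: (nT lambda); exists x.
have ralpha : is_root br alpha.
  split; last by exists e.
  by apply: contraNneq aT => ->; rewrite lfunE.
have [f Wf bef] := form_pairing b_inv b_nd adjoint_decomposition We e0.
have [c [H [sl2 _ Hperp]]] := root_sl2_triple ralpha We Wf bef.
exists (H :: r); split => /=; first by rewrite r_size.
  rewrite free_cons r_free andbT; apply/negP => Hr; case/eqP: aT; apply: Hperp.
  apply: (span_closed (P := fun K : subvs_of h => b (vsval K) (vsval T) = 0)) Hr.
  - by rewrite linear0 linear0l.
  - by move=> a X Y bX bY /=; rewrite linearDl linearZl_LR bX bY /= mulr0 addr0.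
  move=> _ /(nthP 0)[i ir <-]; rewrite r_size in ir.
  exact: (rT (Ordinal ir)).
move=> K; rewrite inE => /predU1P[->|/rP//].
by exists (c *: e), f.
Qed.

Section Module.
Variables (W : vectType F) (act : {bilinear g -> W -> W}).
Hypothesis act_module : lie_module br act.

Lemma triple_act_semisimple e X f : sl2_triple e X f -> semisimple_op (act X).
Proof.
move=> [He Hf ef].
apply: (@sl2_semisimple _ _ (act e) (act f)) => w /=; rewrite (actC act_module).
- by rewrite He linearZl_LR.
- by rewrite Hf linearNl linearZl_LR.
- by rewrite ef.
Qed.

Lemma module_decomposition w :
  vec_sum (fun u => exists lambda, weight_space (h := h) act lambda u) w.
Proof.
have [r r_span rP] := coroots_span.
apply: (weight_decomposition act_module) r_span _ => [|H /rP[e [f]]].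
  exact: cartan_abelian.
exact: triple_act_semisimple.
Qed.

Lemma triple_lowest_weight e H f lambda w :
  sl2_triple e (vsval H) f -> weight_space act lambda w -> w != 0 ->
  act f w = 0 -> exists n, lambda H = - n%:R :> F.
Proof.
move=> [He Hf ef] Ww w0 fw.
apply: (@lowest_weight_nat _ _ (act e) (act f) (act (vsval H)) w) => // [u|u|].
- by rewrite /= (actC act_module) He linearZl_LR.
- by rewrite /= (actC act_module) ef.
- exact: Ww.
Qed.

End Module.

End Cartan.

(** * The two-step nilpotent Lie algebra *)

Section Embeddings.
Variables (F : numClosedFieldType) (g V : vectType F).

Lemma inV_linear : linear (@inV F g V).
Proof.
move=> a u v; rewrite /inV /GRing.scale /GRing.add /= /scale_pair /add_pair /=.
by rewrite scaler0 addr0.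
Qed.

Lemma inG_linear : linear (@inG F g V).
Proof.
move=> a u v; rewrite /inG /GRing.scale /GRing.add /= /scale_pair /add_pair /=.
by rewrite scaler0 addr0.
Qed.

HB.instance Definition _ :=
  GRing.isLinear.Build F V (V * g)%type _ (@inV F g V) inV_linear.
HB.instance Definition _ :=
  GRing.isLinear.Build F g (V * g)%type _ (@inG F g V) inG_linear.

Lemma inG_inj : injective (@inG F g V). Proof. by move=> X Y []. Qed.

Lemma inVG_decomp (x : (V * g)%type) : x = inV x.1 + inG x.2.
Proof. by case: x => v X; rewrite /inV /inG /GRing.add /= /add_pair /= addr0 add0r. Qed.

End Embeddings.

Section Pullback.
Variables (F : numClosedFieldType) (U W : vectType F).

Definition pullback (B : {biscalar W}) (i : {linear U -> W}) (x y : U) : F :=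
  B (i x) (i y).

Lemma pullback_bilinear B i : bilinear_for *%R *%R (pullback B i).
Proof.
split=> z a x y; rewrite /pullback (linearP i).
  by rewrite linearDl linearZl_LR.
by rewrite linearDr linearZr_LR.
Qed.

HB.instance Definition _ B i := bilinear_isBilinear.Build F U U F
  (GRing.Scale.Law.clone _ _ *%R _) (GRing.Scale.Law.clone _ _ *%R _)
  (pullback B i) (pullback_bilinear B i).
End Pullback.

Section TwoStepNilpotent.
Variables (F : numClosedFieldType) (g V : vectType F).
Variables (brg : {bilinear g -> g -> g}) (act : {bilinear g -> V -> V}).
Variables (h : {vspace g}) (B : {symmetric (V * g)%type}).
Variable brn : {bilinear (V * g)%type -> (V * g)%type -> (V * g)%type}.
Hypothesis g_lie : lie_bracket brg.
Hypothesis g_semisimple : lie_semisimple brg.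
Hypothesis h_cartan : cartan_subalgebra brg h.
Hypothesis V_module : lie_module brg act.
Hypothesis B_nondegenerate : nondegenerate B.
Hypothesis B_invariant : invariant_form brg act B.
Hypothesis n_lie : lie_bracket brn.
Hypothesis n_bracket : two_step_bracket act B brn.
Implicit Types (lambda mu alpha : 'Hom(subvs_of h, F^o)) (v w : V) (X Y Z : g).

(* The restrictions of B to V and g are abstract forms, so that simplification
   does not unfold them. *)
Variables (bV : {biscalar V}) (bG : {biscalar g}).
Hypothesis bVE : forall v w, bV v w = B (inV v) (inV w).
Hypothesis bGE : forall X Y, bG X Y = B (inG X) (inG Y).

Let B_sym x y : B x y = B y x.
Proof. by rewrite hermC expr0 mul1r. Qed.

Let B_nd x : (forall y, B x y = 0) -> x = 0.
Proof.
move=> Bx; apply/eqP; rewrite -memv0; move: B_nondegenerate => /eqP <-.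
by apply/mem_orthovP => y _; apply: Bx.
Qed.

Let B_ortho v X : B (inV v) (inG X) = 0.
Proof. by case: B_invariant => ->. Qed.

Let bV_inv X v w : bV (act X v) w + bV v (act X w) = 0.
Proof. by rewrite !bVE; case: B_invariant => _ ->. Qed.

Let bG_inv X Y Z : bG (brg X Y) Z + bG Y (brg X Z) = 0.
Proof. by rewrite !bGE; case: B_invariant => _ _ ->. Qed.

Let bG_sym X Y : bG X Y = bG Y X. Proof. by rewrite !bGE B_sym. Qed.

Let bV_nd v : (forall w, bV v w = 0) -> v = 0.
Proof.
move=> bv; have : inV v = 0 :> (V * g)%type; last by case.
by apply: B_nd => y; rewrite [y]inVG_decomp linearDr /= B_ortho addr0 -bVE bv.
Qed.

Lemma form_g_nondegenerate X : (forall Y, bG X Y = 0) -> X = 0.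
Proof.
move=> bX; have : inG X = 0 :> (V * g)%type; last by case.
by apply: B_nd => y; rewrite [y]inVG_decomp linearDr /= B_sym B_ortho add0r -bGE bX.
Qed.
Let bG_nd := form_g_nondegenerate.

Lemma brn_inG v w : exists Z, brn (inV v) (inV w) = inG Z.
Proof. by case: n_bracket. Qed.

Lemma brn_form v w X Z : brn (inV v) (inV w) = inG Z -> bG Z X = bV (act X v) w.
Proof. by case: n_bracket => _ _ nB E; rewrite bGE bVE -nB E. Qed.

Lemma brn_weight lambda mu v w Z :
  weight_space act lambda v -> weight_space act mu w ->
  brn (inV v) (inV w) = inG Z -> weight_space brg (lambda + mu) Z.
Proof.
move=> Wv Ww E H; apply/eqP; rewrite -subr_eq0; apply/eqP/bG_nd => Y.
rewrite linearBl linearZl_LR /= add_lfunE.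
have /eqP := bG_inv (vsval H) Z Y; rewrite addr_eq0 => /eqP ->.
rewrite !(brn_form _ E) V_module linearBl Wv linearZr_LR linearZl_LR /=.
have /eqP := bV_inv (vsval H) (act Y v) w; rewrite addr_eq0 => /eqP ->.
by rewrite Ww linearZr_LR /=; ring.
Qed.

Let V_decomposition :=
  module_decomposition g_lie g_semisimple h_cartan bG_sym bG_inv bG_nd V_module.
Let g_decomposition := adjoint_decomposition g_lie h_cartan.

Lemma form_V_pairing lambda v :
  weight_space act lambda v -> v != 0 ->
  exists2 w, weight_space act (- lambda) w & bV v w != 0.
Proof. exact: (form_pairing bV_inv bV_nd V_decomposition). Qed.

Let g_pairing alpha X :=
  form_pairing (lambda := alpha) (v := X) bG_inv bG_nd g_decomposition.

(** [B ([v, w], f) = B (f v, w)], and [f v] has weight [- mu]. *)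
Lemma brn_neq0 lambda mu alpha f v :
  lambda + mu = alpha -> weight_space brg (- alpha) f ->
  weight_space act lambda v -> act f v != 0 ->
  exists2 w, weight_space act mu w & brn (inV v) (inV w) != 0.
Proof.
move=> lm Wf Wv fv0; have Wfv := weight_act V_module Wf Wv.
have [w Ww bw] := form_V_pairing Wfv fv0.
have muE : - (lambda - alpha) = mu by rewrite opprB -lm addrC addKr.
exists w; first by rewrite -muE.
have [Z E] := brn_inG v w; rewrite E.
apply: contraNneq bw => /(@inG_inj _ _ _ Z 0) Z0.
by rewrite -(brn_form _ E) Z0 linear0l.
Qed.

(** Root spaces are lines, so a single nonzero bracket spans. *)
Lemma bracket_span_weights lambda mu :
  lambda + mu != 0 ->
  (is_root brg (lambda + mu) -> exists v w,
     [/\ weight_space act lambda v, weight_space act mu w &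
         brn (inV v) (inV w) != 0]) ->
  bracket_span brn (inV @` weight_space act lambda) (inV @` weight_space act mu) =
  inG @` root_space brg (lambda + mu).
Proof.
move=> lm0 neq0; apply/seteqP; split=> x.
  case=> s sP; apply: span_closed => //.
  - exists 0; last by rewrite linear0.
    by rewrite /root_space; case: asboolP => // _; apply: weight_space0.
  - move=> a _ _ [X gX <-] [Y gY <-]; exists (a *: X + Y); last by rewrite linearP.
    move: gX gY; rewrite /root_space; case: asboolP => _; first exact: weight_spaceP.
    by move=> -> ->; rewrite /= scaler0 addr0.
  move=> y /sP[_ [v Wv <-]] [_ [w Ww <-]] <-.
  have [Z E] := brn_inG v w; exists Z => //; have WZ := brn_weight Wv Ww E.
  rewrite /root_space; case: asboolP => // nroot; apply/eqP/negPn/negP => Z0.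
  by apply: nroot; split=> //; exists Z.
case=> X + <-; rewrite /root_space; case: asboolP => [root WX|_ ->]; last first.
  by exists [::] => //; rewrite linear0 mem0v.
have [v [w [Wv Ww]]] := neq0 root; have [Z E] := brn_inG v w; rewrite E => Z0.
have [|c ->] := root_space_line g_lie g_semisimple h_cartan bG_sym bG_inv bG_nd
                  root (brn_weight Wv Ww E) WX.
  by apply: contraNneq Z0 => ->; rewrite linear0.
exists [:: inG Z]; last by rewrite linearZ rpredZ ?memv_span1.
move=> y; rewrite inE => /eqP ->.
by exists (inV v); [exists v | exists (inV w); [exists w |]].
Qed.

(** The lowering element [f] cannot kill both [v] and [w]: it would make them
    lowest weight vectors, of weights whose values at the coroot add up to 2. *)
Lemma brn_root_neq0 lambda mu v w :
  is_root brg (lambda + mu) ->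
  weight_space act lambda v -> weight_space act mu w -> v != 0 -> w != 0 ->
  exists v' w', [/\ weight_space act lambda v', weight_space act mu w' &
         brn (inV v') (inV w') != 0].
Proof.
move=> root Wv Ww v0 w0; have [_ [e We e0]] := root.
have [f Wf bef] := g_pairing We e0.
have [c [H [sl2 aH _]]] :=
  root_sl2_triple g_lie g_semisimple h_cartan bG_sym bG_inv bG_nd root We Wf bef.
have [fv|fv] := eqVneq (act f v) 0; last first.
  by have [w' Ww' E] := brn_neq0 erefl Wf Wv fv; exists v, w'.
have [fw|fw] := eqVneq (act f w) 0; last first.
  have [v' Wv' E] := brn_neq0 (addrC mu lambda) Wf Ww fw; exists v', w; split=> //.
  by rewrite (brC n_lie) oppr_eq0.
have [n nE] := triple_lowest_weight V_module sl2 Wv v0 fv.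
have [m mE] := triple_lowest_weight V_module sl2 Ww w0 fw.
move: aH; rewrite add_lfunE nE mE => /eqP.
by rewrite -opprD -natrD eq_sym -addr_eq0 -natrD pnatr_eq0.
Qed.

(** Here [w] has weight 2 for the coroot, so it is not a lowest weight vector;
    in particular the zero weight space contains [f w != 0]. *)
Lemma brn_root0_neq0 mu w :
  is_root brg mu -> weight_space act mu w -> w != 0 ->
  exists v' w', [/\ weight_space act (0 : 'Hom(subvs_of h, F^o)) v',
                    weight_space act mu w' &
                    brn (inV v') (inV w') != 0].
Proof.
move=> root Ww w0; have [_ [e We e0]] := root.
have [f Wf bef] := g_pairing We e0.
have [c [H [sl2 aH _]]] :=
  root_sl2_triple g_lie g_semisimple h_cartan bG_sym bG_inv bG_nd root We Wf bef.
have [fw|fw] := eqVneq (act f w) 0; last first.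
  have [v' Wv' E] := brn_neq0 (addr0 mu) Wf Ww fw; exists v', w; split=> //.
  by rewrite (brC n_lie) oppr_eq0.
have [m mE] := triple_lowest_weight V_module sl2 Ww w0 fw.
by move: aH; rewrite mE => /eqP; rewrite eq_sym -addr_eq0 -natrD pnatr_eq0.
Qed.

(** The bracket lies in h, and pairing it with [H] gives
    [B (H v, w) = lambda(H) B (v, w)]. *)
Lemma brn_opposite lambda (T : subvs_of h) v w :
  (forall H : subvs_of h, lambda H = B (inG (vsval T)) (inG (vsval H))) ->
  weight_space act lambda v -> weight_space act (- lambda) w ->
  brn (inV v) (inV w) = bV v w *: inG (vsval T).
Proof.
move=> TE Wv Ww; have [Z E] := brn_inG v w; rewrite E.
have := brn_weight Wv Ww E; rewrite subrr => /(weight0_cartan g_lie h_cartan) Zh.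
rewrite -linearZ; congr inG; apply/eqP; rewrite -subr_eq0.
have Kh : Z - bV v w *: vsval T \in h by rewrite rpredB ?rpredZ ?subvsP.
suff: Subvs Kh = 0 by move/(congr1 vsval) => /= ->.
apply: (form_cartan_nd g_lie h_cartan bG_inv bG_nd) => H /=.
by rewrite linearBl linearZl_LR /= (brn_form _ E) Wv linearZl_LR /= TE -bGE mulrC subrr.
Qed.

End TwoStepNilpotent.

Theorem proposition4p7 (R : realType) (g V : vectType R[i])
  (brg : {bilinear g -> g -> g}) (act : {bilinear g -> V -> V})
  (h : {vspace g})
  (B : {symmetric (V * g)%type})
  (brn : {bilinear (V * g)%type -> (V * g)%type -> (V * g)%type})
  (g_lie : lie_bracket brg) (g_semisimple : lie_semisimple brg)
  (h_cartan : cartan_subalgebra brg h)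
  (V_module : lie_module brg act)
  (B_nondegenerate : nondegenerate B)
  (B_invariant : invariant_form brg act B)
  (n_lie : lie_bracket brn)
  (n_bracket : two_step_bracket act B brn) :
  let Lambda := nonzero_weight (h := h) act in
  let V_ (lambda : 'Hom(subvs_of h, R[i]^o)) : set (V * g)%type :=
    inV @` weight_space act lambda in
  let g_ (mu : 'Hom(subvs_of h, R[i]^o)) : set (V * g)%type :=
    inG @` root_space brg mu in
  [/\ (forall lambda, Lambda lambda ->
         exists t : subvs_of h,
           unique (fun t => forall H : subvs_of h,
             lambda H = B (inG (vsval t)) (inG (vsval H))) t /\
           forall v, weight_space act lambda v -> v != 0 ->
             brn (inV v) @` V_ (- lambda) =
             [set c *: inG (vsval t) | c in [set: R[i]]]),
      (forall lambda mu, Lambda lambda -> Lambda mu -> lambda + mu != 0 ->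
         bracket_span brn (V_ lambda) (V_ mu) = g_ (lambda + mu)),
      (forall mu, Lambda mu -> bracket_span brn (V_ 0) (V_ mu) = g_ mu) &
      bracket_span brn (V_ 0) (V_ 0) = [set 0]].
Proof.
move=> Lambda V_ g_.
pose bV : {biscalar V} := pullback B (@inV _ g V).
pose bG : {biscalar g} := pullback B (@inG _ g V).
have bVE v w : bV v w = B (inV v) (inV w) by [].
have bGE X Y : bG X Y = B (inG X) (inG Y) by [].
have bG_inv X Y Z : bG (brg X Y) Z + bG Y (brg X Z) = 0.
  by case: B_invariant => _ _ ->.
have bG_nd := form_g_nondegenerate B_nondegenerate B_invariant bGE.
have span_weights := bracket_span_weights g_lie g_semisimple h_cartan V_module
  B_nondegenerate B_invariant n_bracket bVE bGE.
have opposite := brn_opposite g_lie h_cartan V_module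
  B_nondegenerate B_invariant n_bracket bVE bGE.
split.
- move=> lambda _.
  have [t tE] := weight_representation g_lie h_cartan bG_inv bG_nd lambda.
  exists t; split=> [|v Wv v0].
    split=> // t' t'E; apply/eqP; rewrite -subr_eq0; apply/eqP.
    apply: (form_cartan_nd g_lie h_cartan bG_inv bG_nd) => H.
    by rewrite linearB linearBl -tE bGE -t'E subrr.
  have [w0 Ww0 bw0] := form_V_pairing g_lie g_semisimple h_cartan V_module
    B_nondegenerate B_invariant bVE bGE Wv v0.
  apply/seteqP; split=> x.
    case=> _ [w Ww <-] <-; exists (bV v w) => //.
    by rewrite (opposite _ _ _ _ tE Wv Ww).
  case=> c _ <-; pose w := (c / bV v w0) *: w0.
  have Ww : weight_space act (- lambda) w by apply: weight_spaceZ.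
  exists (inV w); first by exists w.
  by rewrite (opposite _ _ _ _ tE Wv Ww) linearZr_LR /= divfK.
- move=> lambda mu [_ [v Wv v0]] [_ [w Ww w0]] lm0.
  apply: span_weights => // root.
  exact: (brn_root_neq0 g_lie g_semisimple h_cartan V_module B_nondegenerate
    B_invariant n_lie n_bracket bVE bGE root Wv Ww v0 w0).
- move=> mu [mu0 [w Ww w0]].
  rewrite /V_ /g_ -[in RHS](add0r mu).
  apply: span_weights; rewrite add0r // => root.
  exact: (brn_root0_neq0 g_lie g_semisimple h_cartan V_module B_nondegenerate
    B_invariant n_lie n_bracket bVE bGE root Ww w0).
- apply/seteqP; split=> x /=; last by move=> ->; exists [::]; rewrite ?mem0v.
  case=> s sP; apply: (span_closed (P := fun x => x = 0)) => // [a u v -> ->|].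
    by rewrite scaler0 addr0.
  move=> y /sP[_ [v Wv <-] [_ [w Ww <-] <-]].
  rewrite (opposite 0 0 v w) ?oppr0 //; first by rewrite !linear0.
  by move=> H; rewrite lfunE /= linear0 linear0l.
Qed.
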